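(* There is an absolute constant $c>0$ with the following property. For every sufficiently small $\varepsilon>0$ and every sufficiently large $n$, there exists a planar graph $H$ on $n$ vertices with maximum degree bounded by an absolute constant such that any property tester for the property $\{H\}$ with proximity parameter $\varepsilon$ makes at least $\exp(c\,\varepsilon^{-2})$ queries. Equivalently, testing isomorphism to $H$ requires $\exp(\Omega(\varepsilon^{-2}))$ queries.
   Context: Bounded-degree graph model: the input is a graph $G$ with vertex set $[n]$ and maximum degree at most $d$. The tester accesses $G$ through neighbor queries: given $v$ and $i\in[d]$, the oracle returns the $i$-th neighbor of $v$, or $\bot$ if there is none. The property $\{H\}$ is the set of graphs isomorphic to $H$. The distance of $G$ to $\{H\}$ is the minimum number of edge additions and removals that make $G$ isomorphic to $H$, divided by $dn$. $G$ is $\varepsilon$-far if this distance exceeds $\varepsilon$. A property tester with proximity parameter $\varepsilon$ is a randomized query algorithm with two guarantees. It accepts with probability at least $2/3$ if $G\cong H$. It rejects with probability at least $2/3$ if $G$ is $\varepsilon$-far from $\{H\}$. *)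

(* Defs.v *)
From HB Require Import structures.
From mathcomp Require Import all_boot all_order all_fingroup all_algebra.
From mathcomp Require Import all_classical all_reals all_analysis.
Import Order.TTheory GRing.Theory Num.Theory.
Import numFieldNormedType.Exports.

Set Implicit Arguments.
Unset Strict Implicit.
Unset Printing Implicit Defensive.

Local Open Scope classical_set_scope.
Local Open Scope set_scope.
Local Open Scope ring_scope.

Record sgraph (n : nat) := SGraph {
  edges : {set {set 'I_n}};
  edges_card2 : [forall e in edges, #|e| == 2]
}.

HB.instance Definition _ (n : nat) := [isSub for @edges n].
HB.instance Definition _ (n : nat) := [Equality of sgraph n by <:].
HB.instance Definition _ (n : nat) := [Choice of sgraph n by <:].
HB.instance Definition _ (n : nat) := [Countable of sgraph n by <:].
HB.instance Definition _ (n : nat) := [Finite of sgraph n by <:].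

Definition adj (n : nat) (G : sgraph n) : rel 'I_n :=
  fun x y => [set x; y] \in edges G.

Definition nbrs (n : nat) (G : sgraph n) (x : 'I_n) : {set 'I_n} :=
  [set y | adj G x y].

Definition max_degree (n : nat) (G : sgraph n) : nat :=
  (\max_(x < n) #|nbrs G x|)%N.

Definition isomorphic (n : nat) (G K : sgraph n) : bool :=
  [exists s : {perm 'I_n}, forall x, forall y, adj G x y == adj K (s x) (s y)].

Section Planarity.
Variables (R : realType) (n : nat).
Implicit Types (pos : 'I_n -> R * R) (arc : {set 'I_n} -> R -> R * R).

Definition simple_arc (gamma : R -> R * R) (a b : R * R) : Prop :=
  [/\ {within `[0, 1], continuous gamma},
      {in `[0, 1] &, injective gamma},
      gamma 0 = a & gamma 1 = b].

(** [arc] is only constrained on the edges of [G]; the direction in which an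
    edge is traversed is immaterial. *)
Definition plane_drawing (G : sgraph n) pos arc : Prop :=
  [/\ injective pos,
      (forall e, e \in edges G ->
         exists x y : 'I_n, e = [set x; y] /\
           simple_arc (arc e) (pos x) (pos y)),
      (forall e (t : R) (v : 'I_n),
         e \in edges G -> t \in `]0, 1[ -> arc e t <> pos v)
    & (forall e f (s t : R),
         e \in edges G -> f \in edges G -> e != f ->
         s \in `]0, 1[ -> t \in `]0, 1[ -> arc e s <> arc f t)].

Definition planar (G : sgraph n) : Prop :=
  exists pos arc, plane_drawing G pos arc.

End Planarity.

Definition edits (n : nat) (G K : sgraph n) : nat :=
  #|(edges G :\: edges K) :|: (edges K :\: edges G)|.

Definition edit_distance (n : nat) (G H : sgraph n) : nat :=
  edits G [arg min_(K < H | isomorphic K H) edits G K].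

Definition distance (R : realType) (d n : nat) (G H : sgraph n) : R :=
  (edit_distance G H)%:R / (d * n)%N%:R.

Definition far (R : realType) (d n : nat) (eps : R) (G H : sgraph n) : Prop :=
  eps < distance R d G H.

(** [o v i] is the answer to the query "[i]-th neighbour of [v]", with [None]
    standing for "there is none"; indices start at 0. *)
Definition oracle (d n : nat) : Type := 'I_n -> 'I_d -> option 'I_n.

(** The neighbours of each vertex may be listed in any order. *)
Definition represents (d n : nat) (o : oracle d n) (G : sgraph n) : Prop :=
  forall v, exists2 s : seq 'I_n,
    perm_eq s (enum (nbrs G v)) & forall i : 'I_d, o v i = onth s i.

Definition is_input (d n : nat) (G : sgraph n) (o : oracle d n) : Prop :=
  (max_degree G <= d)%N /\ represents o G.

(** Deterministic adaptive algorithms; [Answer true] means "accept". *)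
Inductive dtree (d n : nat) : Type :=
| Answer of bool
| Query of 'I_n & 'I_d & (option 'I_n -> dtree d n).

Fixpoint accepts (d n : nat) (t : dtree d n) (o : oracle d n) : bool :=
  match t with
  | Answer b => b
  | Query v i k => accepts (k (o v i)) o
  end.

Fixpoint num_queries (d n : nat) (t : dtree d n) (o : oracle d n) : nat :=
  match t with
  | Answer _ => 0%N
  | Query v i k => (num_queries (k (o v i)) o).+1
  end.

(** A randomized algorithm is a random deterministic one, over an arbitrary
    probability space of internal coin tosses. *)
Record ralgo (R : realType) (d n : nat) := RAlgo {
  coins_display : measure_display;
  coins : measurableType coins_display;
  coins_prob : probability coins R;
  strategy : coins -> dtree d n;
  measurable_accepts : forall o : oracle d n,
    measurable [set w : coins | accepts (strategy w) o]%classic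
}.

Definition prob_accept (R : realType) (d n : nat) (A : ralgo R d n)
    (o : oracle d n) : \bar R :=
  coins_prob A [set w | accepts (strategy w) o]%classic.

Definition prob_reject (R : realType) (d n : nat) (A : ralgo R d n)
    (o : oracle d n) : \bar R :=
  coins_prob A [set w | ~~ accepts (strategy w) o]%classic.

Definition is_tester (R : realType) (d n : nat) (eps : R) (H : sgraph n)
    (A : ralgo R d n) : Prop :=
  forall (G : sgraph n) (o : oracle d n), is_input G o ->
    (isomorphic G H -> ((2 / 3)%:E <= prob_accept A o)%E) /\
    (far d eps G H -> ((2 / 3)%:E <= prob_reject A o)%E).

(** Worst case over all inputs and all coin tosses. *)
Definition makes_at_most (R : realType) (d n : nat) (A : ralgo R d n)
    (q : nat) : Prop :=
  forall (G : sgraph n) (o : oracle d n), is_input G o ->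
    forall w : coins A, (num_queries (strategy w) o <= q)%N.

(* Main.v *)
Require Import Defs.
From mathcomp Require Import all_boot all_order all_fingroup all_algebra.
From mathcomp Require Import all_classical all_reals all_analysis.
From mathcomp Require Import measurable_realfun zify ring lra.
From mathcomp Require Import fintype finset bigop.
Import Order.TTheory GRing.Theory Num.Theory.
Import numFieldNormedType.Exports.

(** The graph [H] consists of equally many copies of each of [2 P] labelled
    [L x L] grids, with [L] of order [1 / eps]. The labels are the words of a code
    of exponential size in [L ^ 2] with linear distance, and a label is stored as
    a number of leaves hanging from the cell.

    If few edges of an embedded grid are edited, then some full row and some full
    column survive, and together they force almost all cells, hence almost all
    labels, to be preserved. So a component whose word does not occur in [G]
    costs [L / 20] edits, and [G] is [eps]-far from [H] as soon as half of the
    words do not occur in it.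

    A yes-instance assigns the words to the components by a random bijection, a
    no-instance by a random map onto at most [P] random words. A query reveals at
    most one word, and without a collision among [q] queries, which has
    probability at most [q ^ 2 / P], both look the same. Hence [P <= 2 * q ^ 2]. *)

Set Implicit Arguments.
Unset Strict Implicit.
Unset Printing Implicit Defensive.

Local Open Scope ring_scope.

(** * Decision trees and random words *)

Section DecisionTrees.
Local Open Scope nat_scope.
Variables (T V : finType) (d n : nat).
Variables (pos : 'I_n -> T) (ans : 'I_n -> 'I_d -> V -> option 'I_n).
Implicit Types (D : {set T}) (w : {ffun T -> V}).

(** A query reveals one value of the hidden word [w], which turns a query tree into a decision tree
    on words. *)
Definition word_oracle w : oracle d n := fun v i => ans v i (w (pos v)).

Definition agree D w w' := [forall t in D, w' t == w t].

(** The words leading to a given leaf form a cylinder with at most [q] prescribed values, and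
    cylinders of different leaves are disjoint; so domination on cylinders adds up over the
    accepting leaves. *)
Lemma dtree_domination (mu nu : {ffun T -> V} -> nat) (q : nat) :
    (forall D w, #|D| <= q ->
       \sum_(w' | agree D w w') mu w' <= \sum_(w' | agree D w w') nu w') ->
  forall t : dtree d n,
    (forall w, num_queries t (word_oracle w) <= q) ->
  \sum_(w | accepts t (word_oracle w)) mu w
    <= \sum_(w | accepts t (word_oracle w)) nu w.
Proof.
move=> dom t tq.
(* [D] holds the positions read so far, [w] records their values, and [u] is the rest of the
   tree. *)
suff main : forall (u : dtree d n) D w,
    (forall w', agree D w w' -> #|D| + num_queries u (word_oracle w') <= q) ->
  \sum_(w' | agree D w w' && accepts u (word_oracle w')) mu w'
    <= \sum_(w' | agree D w w' && accepts u (word_oracle w')) nu w'.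
  have [w _|no] := pickP (@predT {ffun T -> V}); last first.
    by rewrite big_pred0 // => w; have := no w.
  have := main t set0 w; have E w' : agree set0 w w'.
    by apply/forall_inP => x; rewrite inE.
  under eq_bigl do rewrite E; under [in X in _ <= X]eq_bigl do rewrite E.
  by apply => w' _; rewrite cards0; exact: tq.
elim=> [b|v i k IH] D w uq /=.
  case: b uq => /= uq; last by rewrite !big_pred0 // => w'; rewrite andbF.
  under eq_bigl do rewrite andbT; under [in X in _ <= X]eq_bigl do rewrite andbT.
  apply: dom; have /uq : agree D w w by apply/forall_inP.
  by rewrite addn0.
rewrite (partition_big (fun w' => w' (pos v)) xpredT) //=.
rewrite [X in _ <= X](partition_big (fun w' => w' (pos v)) xpredT) //=.
apply: leq_sum => y _.
(* An answer contradicting a value already read contributes nothing. *)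
have [Dv|Dv] := boolP ((pos v \in D) && (w (pos v) != y)).
  rewrite big_pred0 // => w'; apply/negP => /andP[/andP[/forall_inP aw _] /eqP wy].
  by case/andP: Dv => /aw /eqP <-; rewrite wy eqxx.
pose w1 := [ffun t => if t == pos v then y else w t].
have E w' : agree D w w' && (w' (pos v) == y) = agree (pos v |: D) w1 w'.
  apply/andP/forall_inP => [[/forall_inP aw /eqP wy] x|aw].
    rewrite !inE ffunE; case: eqP => [->|_] /=; first by rewrite wy.
    exact: aw.
  have /aw := setU11 (pos v) D; rewrite ffunE eqxx => /eqP wy; split; last exact/eqP.
  apply/forall_inP => x xD; have /aw := setU1r (pos v) xD; rewrite ffunE.
  case: (x =P pos v) xD => // -> vD /eqP ->; move: Dv; rewrite vD /= negbK => /eqP ->.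
  by rewrite eqxx.
have E2 w' : [&& agree D w w', accepts (k (ans v i (w' (pos v)))) (word_oracle w')
     & w' (pos v) == y]
   = agree (pos v |: D) w1 w' && accepts (k (ans v i y)) (word_oracle w').
  by rewrite -E; case: (w' (pos v) =P y) => [->|]; rewrite ?andbT ?andbF.
under eq_bigl do rewrite -andbA E2.
under [in X in _ <= X]eq_bigl do rewrite -andbA E2.
apply: IH => w'; rewrite -E => /andP[aw /eqP wy].
have := uq w' aw; rewrite /= /word_oracle wy.
move: (num_queries _ _) => m; have := cardsU1 (pos v) D; case: (_ \notin _) => /=; lia.
Qed.

End DecisionTrees.

(** * Random permutations, and their composition with random maps *)

Section RandomWords.
Local Open Scope nat_scope.
Variable T : finType.
Implicit Types (D : {set T}).

(** List [D] followed by its complement, and [g(D)] followed by its complement; entries with equal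
    index are matched. *)
Lemma perm_extends_injection (D : {set T}) (g : T -> T) :
  {in D &, injective g} -> exists s : {perm T}, {in D, s =1 g}.
Proof.
move=> gI; pose rest (s : seq T) := [seq x <- enum T | x \notin s].
have full (s : seq T) : uniq s -> perm_eq (s ++ rest s) (enum T).
  move=> us; apply: uniq_perm (enum_uniq _) _ => [|x].
    rewrite cat_uniq us filter_uniq ?enum_uniq // andbT.
    by apply/hasPn => x; rewrite mem_filter => /andP[].
  by rewrite mem_cat mem_filter mem_enum andbT orbN.
pose s1 := enum D; pose s2 := [seq g x | x <- s1].
have u1 : uniq s1 := enum_uniq _.
have u2 : uniq s2.
  by rewrite map_inj_in_uniq // => x y; rewrite !mem_enum; apply: gI.
have sz : size (s1 ++ rest s1) = size (s2 ++ rest s2).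
  by rewrite (perm_size (full _ u1)) (perm_size (full _ u2)).
have in1 x : x \in s1 ++ rest s1 by rewrite (perm_mem (full _ u1)) mem_enum.
pose f x := nth x (s2 ++ rest s2) (index x (s1 ++ rest s1)).
have fI : injective f.
  move=> x y; rewrite /f (set_nth_default y x) -?sz ?index_mem // => /eqP.
  rewrite nth_uniq -?sz ?index_mem ?in1 //; last first.
    by rewrite (perm_uniq (full _ u2)) enum_uniq.
  by move=> /eqP/(congr1 (nth x (s1 ++ rest s1))); rewrite !nth_index.
exists (perm fI) => x xD; rewrite permE /f index_cat mem_enum xD.
have xs : index x s1 < size s1 by rewrite index_mem mem_enum.
by rewrite nth_cat size_map xs (nth_map x) // nth_index // mem_enum.
Qed.

(** Extend [g] from [D] to a permutation [s]; multiplication by [s] on the left carries the first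
    set onto the second. *)
Lemma card_perm_comp_agree (D : {set T}) (g : T -> T) (w : {ffun T -> T}) :
    {in D &, injective g} ->
  #|[set r : {perm T} | agree D w [ffun t => r (g t)]]|
    = #|[set r : {perm T} | agree D w [ffun t => r t]]|.
Proof.
move=> /perm_extends_injection[s sg].
rewrite -(card_imset [set r : {perm T} | agree D w [ffun t => r (g t)]]
  (@mulgI _ s)); apply: eq_card => r.
rewrite [RHS]inE; apply/imsetP/forall_inP => [[r' + ->]|rw].
  rewrite inE => /forall_inP rw t tD; have := rw t tD.
  by rewrite !ffunE permM sg.
exists (s^-1 * r)%g; last by rewrite mulKVg.
rewrite inE; apply/forall_inP => t tD; have := rw t tD.
by rewrite !ffunE permM -(sg t tD) permK.
Qed.

(** Union bound over the ordered pairs of distinct points of [D], each colliding for at most a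
    fraction [1 / P] of the maps. *)
Lemma card_ffun_collision (P : nat) (D : {set T}) :
  P * #|[set g : {ffun T -> 'I_P} | ~~ [forall a in D, forall b in D,
          (g a == g b) ==> (a == b)]]| <= #|D| ^ 2 * #|{ffun T -> 'I_P}|.
Proof.
pose col (p : T * T) := [set g : {ffun T -> 'I_P} | g p.1 == g p.2].
pose prs := [set p in setX D D | p.1 != p.2].
have colE p : p \in prs -> P * #|col p| <= #|{ffun T -> 'I_P}|.
  rewrite !inE => /andP[_ ab].
  have -> : P * #|col p| = #|setX [set: 'I_P] (col p)|.
    by rewrite cardsX cardsT card_ord.
  (* Overwriting the value at [p.1] loses nothing: for a colliding [g] it can be read off at
     [p.2]. *)
  pose h (yg : 'I_P * {ffun T -> 'I_P}) :=
    [ffun t => if t == p.1 then yg.1 else yg.2 t].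
  rewrite -(card_in_imset (f := h)); first exact: max_card.
  move=> [y g] [y' g']; rewrite !inE /= => /eqP gp /eqP gp' /ffunP hE.
  have hb : g p.2 = g' p.2 by have := hE p.2; rewrite !ffunE eq_sym (negPf ab).
  congr (_, _); first by have := hE p.1; rewrite !ffunE eqxx.
  apply/ffunP => t; have := hE t; rewrite !ffunE /=.
  by case: eqP => [-> _|//]; rewrite gp gp'.
set B := [set g | _].
have sB : B \subset \bigcup_(p in prs) col p.
  apply/subsetP => g; rewrite inE negb_forall_in => /exists_inP[a aD].
  rewrite negb_forall_in => /exists_inP[b bD]; rewrite negb_imply => /andP[gab ab].
  by apply/bigcupP; exists (a, b); rewrite !inE /= ?aD ?bD.
apply: (@leq_trans (P * \sum_(p in prs) #|col p|)).
  rewrite leq_mul2l; apply/orP; right; apply: (leq_trans (subset_leq_card sB)).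
  elim/big_rec2: _ => [|p m C _ IH]; first by rewrite cards0.
  by apply: (leq_trans (leq_card_setU _ _)); rewrite leq_add2l.
rewrite big_distrr /=; apply: (@leq_trans (\sum_(p in prs) #|{ffun T -> 'I_P}|)).
  exact: leq_sum.
rewrite sum_nat_const leq_mul2r; apply/orP; right.
rewrite -mulnn -cardsX; apply: subset_leq_card.
by apply/subsetP => p; rewrite inE => /andP[].
Qed.

(** In terms of probabilities: every event given by at most [q] prescribed
    values is at most [1 / (1 - q ^ 2 / P)] times likelier for a random
    bijection than for a random bijection composed with a random map into a set
    of size [P], because that map has no collision among [q] given points with
    probability at least [1 - q ^ 2 / P]. *)
Lemma perm_comp_domination (P q : nat) (h : 'I_P -> T) (D : {set T})
    (w : {ffun T -> T}) : injective h -> #|D| <= q ->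
  (P - q ^ 2) * #|{ffun T -> 'I_P}| *
      #|[set r : {perm T} | agree D w [ffun t => r t]]|
    <= P * #|[set x : {perm T} * {ffun T -> 'I_P} |
               agree D w [ffun t => x.1 (h (x.2 t))]]|.
Proof.
move=> hI Dq; set a := #|[set r : {perm T} | _]|.
pose good := [set g : {ffun T -> 'I_P} | [forall a in D, forall b in D,
          (g a == g b) ==> (a == b)]].
have goodN : (P - q ^ 2) * #|{ffun T -> 'I_P}| <= P * #|good|.
  have := card_ffun_collision P D; have := cardsC good.
  set B := [set g | _]; have -> : ~: good = B by apply/setP => g; rewrite !inE.
  move=> <- cB; have : P * #|B| <= q ^ 2 * (#|good| + #|B|).
    by apply: leq_trans cB _; rewrite leq_mul2r leq_exp2r // Dq orbT.
  by rewrite mulnBl !mulnDr; lia.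
(* Only the maps injective on [D] are kept; by symmetry each of them contributes exactly [a]
   permutations. *)
apply: (@leq_trans (P * #|good| * a)); first by rewrite leq_mul2r goodN orbT.
rewrite -mulnA leq_mul2l; apply/orP; right.
rewrite -sum_nat_const.
have -> : \sum_(g in good) a = \sum_(g in good)
    #|[set r : {perm T} | agree D w [ffun t => r (h (g t))]]|.
  apply: eq_bigr => g; rewrite inE => /forall_inP gI.
  rewrite card_perm_comp_agree // => s t sD tD /hI gst.
  by have /forall_inP/(_ t tD) := gI s sD; rewrite gst eqxx => /eqP.
rewrite [X in _ <= X](_ : _ = \sum_(g : {ffun T -> 'I_P})
    #|[set r : {perm T} | agree D w [ffun t => r (h (g t))]]|).
  by rewrite [X in _ <= X](bigID (mem good)) /= leq_addr.
under eq_bigr do rewrite -sum1dep_card; rewrite -sum1dep_card.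
rewrite (exchange_big_dep xpredT) //=.
by rewrite (pair_big_dep xpredT 
    (fun (r : {perm T}) (g : {ffun T -> 'I_P}) =>
       agree D w [ffun t => r (h (g t))])
  (fun _ _ => 1)) /=; apply: eq_bigl => -[].
Qed.

End RandomWords.

(** * Codes *)

Lemma leq_wexp2r (a b e : nat) : (a <= b -> a ^ e <= b ^ e)%N.
Proof. by case: e => // e ab; rewrite leq_exp2r. Qed.

Section Codes.
Local Open Scope nat_scope.
Variable T : finType.
Implicit Types x y : {ffun T -> bool}.

Definition hdist x y := #|[set t | x t != y t]|.

(** Expansion of [(2 + 1) ^ #|T|]: a coordinate contributes 2 if it agrees with [x], and 1
    otherwise. *)
Lemma sum_exp_hdist x : \sum_(y : {ffun T -> bool}) 2 ^ (#|T| - hdist x y) = 3 ^ #|T|.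
Proof.
transitivity (\sum_(y : {ffun T -> bool}) \prod_t (if x t == y t then 2 else 1)).
  apply: eq_bigr => y _; rewrite -big_mkcond /= prod_nat_const; congr (_ ^ _).
  rewrite -(cardsC [set t | x t != y t]) /hdist addKn.
  by apply: eq_card => t; rewrite !inE negbK.
rewrite -(bigA_distr_bigA (fun t b => if x t == b then 2 else 1)) /=.
rewrite -prod_nat_const; apply: eq_bigr => t _.
by rewrite big_bool /=; case: (x t).
Qed.

(** The balls around a maximal separated set cover the cube, so a bound on the size of a ball bounds
    the set from below. Tenth powers avoid fractional exponents. *)
Lemma gilbert_varshamov : exists F : {set {ffun T -> bool}},
  {in F &, forall x y, x != y -> #|T| <= 10 * hdist x y} /\
  8 ^ #|T| <= #|F| ^ 10.
Proof.
set k := #|T|.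
pose sep (F : {set {ffun T -> bool}}) :=
  [forall x in F, forall y in F, (x != y) ==> (k <= 10 * hdist x y)].
have sep0 : sep set0 by apply/forall_inP => x; rewrite inE.
have [F /maxsetP[sepF maxF] _] := maxset_exists sep0.
exists F; split.
  move=> x y xF yF xy; move/forall_inP/(_ x xF)/forall_inP/(_ y yF): sepF.
  by rewrite xy.
pose ball x := [set y | 10 * hdist x y < k].
have hsym x y : hdist x y = hdist y x.
  by apply: eq_card => t; rewrite !inE eq_sym.
have hxx x : hdist x x = 0 by apply: eq_card0 => t; rewrite !inE eqxx.
have cover : [set: {ffun T -> bool}] \subset
    F :|: \bigcup_(x in F) ball x.
  apply/subsetP => y _; rewrite inE; case: (boolP (y \in F)) => //= yF.
  apply/negPn/negP => nb; case/negP: yF.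
  have far x : x \in F -> k <= 10 * hdist x y.
    move=> xF; rewrite leqNgt; apply/negP => lt; case/negP: nb.
    by apply/bigcupP; exists x => //; rewrite inE.
  rewrite -(maxF (y |: F)) ?subsetUr ?setU11 //.
  apply/forall_inP => a; rewrite !inE => aF; apply/forall_inP => b.
  rewrite !inE => bF; apply/implyP => ab.
  case/predU1P: aF ab => [->|aF]; case/predU1P: bF => [->|bF] ab.
  - by rewrite eqxx in ab.
  - by rewrite hsym far.
  - by rewrite far.
  - by move/forall_inP/(_ a aF)/forall_inP/(_ b bF): sepF; rewrite ab.
(* Chernoff-style: every word of the ball has weight at least [2 ^ e] in a sum equal to [3 ^ k],
   where [e] is at least [9 k / 10]. *)
have ballE x : (2 ^ (9 * k)) * #|ball x| ^ 10 <= 3 ^ (10 * k).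
  pose e := k - (k.-1 %/ 10).
  have /(leq_pexp2l (isT : 0 < 2)) e9 : 9 * k <= 10 * e.
    by rewrite /e; lia.
  apply: (@leq_trans ((2 ^ e * #|ball x|) ^ 10)).
    rewrite expnMn -expnM leq_mul2r; apply/orP; right.
    by rewrite [e * 10]mulnC.
  rewrite [10 * k]mulnC expnM leq_exp2r // -(sum_exp_hdist x) mulnC -sum_nat_const.
  rewrite [X in _ <= X](bigID (mem (ball x))) /=; apply: leq_trans (leq_addr _ _).
  apply: leq_sum => y; rewrite inE => lt; apply: leq_pexp2l => //.
  by rewrite -/k /e; lia.
pose b := \max_(x in F) #|ball x|.
have bE : 2 ^ (9 * k) * b ^ 10 <= 3 ^ (10 * k).
  rewrite /b; elim/big_ind: _ => [||x _]; last exact: ballE.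
  - by rewrite exp0n // muln0.
  - by move=> b1 b2 h1 h2; rewrite /maxn; case: ifP.
have card_all : #|[set: {ffun T -> bool}]| = 2 ^ k.
  by rewrite cardsT card_ffun card_bool.
(* For [k = 0] the strict inequality makes the balls empty, and [F] alone covers. *)
have [k0|k_gt0] := posnP k.
  have := subset_leq_card cover; rewrite card_all k0.
  rewrite [X in _ :|: X]big1 => [|x _]; last first.
    by apply/setP => y; rewrite !inE k0.
  by rewrite setU0 !expn0 expn_gt0 => ->.
have Fb : 2 ^ k <= #|F| * b.
  rewrite -card_all; apply: (@leq_trans #|\bigcup_(x in F) ball x|).
    apply: subset_leq_card; apply: subset_trans cover _; rewrite subUset subxx andbT.
    by apply/subsetP => y yF; apply/bigcupP; exists y => //; rewrite inE hxx.
  apply: (@leq_trans (\sum_(x in F) #|ball x|)).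
    elim/big_rec2: _ => [|x m C _ IH]; first by rewrite cards0.
    by apply: (leq_trans (leq_card_setU _ _)); rewrite leq_add2l.
  by rewrite -sum_nat_const; apply: leq_sum => x xF; apply: leq_bigmax_cond.
have c3 : 0 < 3 ^ (10 * k) by rewrite expn_gt0.
rewrite -(leq_pmul2r c3).
(* This is [8 * 3 ^ 10 <= 2 ^ 19], a consequence of [3 ^ 5 <= 2 ^ 8]. *)
apply: (@leq_trans (2 ^ (9 * k) * (2 ^ k) ^ 10)).
  have -> : 2 ^ (9 * k) * (2 ^ k) ^ 10 = (2 ^ 3 * (2 ^ 8) ^ 2) ^ k.
    by rewrite -!expnM -!expnD -expnM; congr (_ ^ _); lia.
  rewrite expnM -expnMn; apply: leq_wexp2r.
  by rewrite leq_mul2l (expnM 3 5 2) leq_exp2r.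
apply: (@leq_trans (2 ^ (9 * k) * (#|F| * b) ^ 10)).
  by rewrite leq_mul2l leq_exp2r // Fb orbT.
by rewrite expnMn mulnCA leq_mul2l bE orbT.
Qed.

End Codes.

(** * Graphs made of labelled grids *)

Section SymmetricClosure.
Local Open Scope nat_scope.
Variable n : nat.
Implicit Types a : rel 'I_n.

Lemma set2_inj (T : finType) (x y z t : T) :
  [set x; y] = [set z; t] -> (x = z /\ y = t) \/ (x = t /\ y = z).
Proof.
move=> E; have := set21 x y; have := set22 x y; rewrite E !inE.
have := set21 z t; have := set22 z t; rewrite -E !inE.
by do 4 case/orP=> /eqP ?; subst; auto.
Qed.

Definition arrow_edges a : {set {set 'I_n}} :=
  [set [set p.1; p.2] | p : 'I_n * 'I_n & a p.1 p.2 && (p.1 != p.2)].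

Fact arrow_edges_card2 a : [forall e in arrow_edges a, #|e| == 2].
Proof.
by apply/forall_inP => e /imsetP[p]; rewrite inE => /andP[_ np] ->; rewrite cards2 np.
Qed.

Definition graph_of a : sgraph n := SGraph (arrow_edges_card2 a).

Lemma adj_graph_of a x y :
  adj (graph_of a) x y = (x != y) && (a x y || a y x).
Proof.
apply/imsetP/andP => [[[z t]]|[xy /orP[axy|ayx]]].
- by rewrite inE /= => /andP[azt zt] /set2_inj[] [-> ->]; rewrite azt ?orbT // eq_sym.
- by exists (x, y); rewrite ?inE //= axy.
- by exists (y, x); rewrite ?inE /= ?ayx 1?eq_sym // finset.setUC.
Qed.

End SymmetricClosure.

Section Pieces.
Local Open Scope nat_scope.
Variables (m N L r : nat).

Definition comp := ('I_m * 'I_N)%type.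
Definition cell := ('I_L * 'I_L)%type.
Definition word := {ffun cell -> bool}.

(** In [inl (K, p, o)], [K] is a component and [p] a cell of its grid; the
    vertex of the grid itself is [o = None], and [Some a] are slots for leaves
    hanging from it. [inr] is padding. *)
Definition vert := (comp * cell * option 'I_90 + 'I_r)%type.

(** The residues mod 3 allow to tell apart the neighbours of a cell. *)
Definition cls (p : cell) (b : bool) : nat :=
  1 + b + 2 * (p.2 %% 3) + 6 * (p.1 %% 3).

Definition rstep (p q : cell) := (p.1 == q.1) && (p.2.+1 == q.2 :> nat).
Definition ustep (p q : cell) := (p.2 == q.2) && (p.1.+1 == q.1 :> nat).

Implicit Types (lab : 'I_N -> word) (K : comp) (p q : cell) (u v : vert).

Definition core K p : vert := inl (K, p, None).

Definition arrow lab u v : bool :=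
  match u, v with
  | inl (K, p, None), inl (K', q, None) => (K == K') && (rstep p q || ustep p q)
  | inl (K, p, None), inl (K', q, Some a) =>
      [&& K == K', p == q & a < 5 * cls p (lab K.2 p)]
  | _, _ => false
  end.

Definition link lab u v := arrow lab u v || arrow lab v u.

Definition deg lab u := #|[set v | link lab u v]|.

Lemma cls_inj p q b c : cls p b = cls q c ->
  [/\ b = c, p.1 %% 3 = q.1 %% 3 & p.2 %% 3 = q.2 %% 3].
Proof. by rewrite /cls; case: b; case: c => /= E; split=> //; lia. Qed.

Lemma cls_bounds p b : 0 < cls p b <= 18.
Proof. by rewrite /cls; case: b => /=; lia. Qed.

Lemma arrow_irr lab u : arrow lab u u = false.
Proof.
case: u => [[[K p] [a|]]|x] //=; rewrite /rstep /ustep !eqxx /=.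
by rewrite !(gtn_eqF (ltnSn _)).
Qed.

Lemma card_ord_lt k l : k <= l -> #|[set a : 'I_l | a < k]| = k.
Proof.
move=> kl; have inj : injective (widen_ord kl) by move=> x y /(congr1 val)/= /val_inj.
rewrite -[RHS]card_ord -cardsT -(card_imset _ inj); apply: eq_card => a.
rewrite !inE; apply/idP/imsetP => [ak|[b _ ->]] //=.
by exists (Ordinal ak); rewrite ?inE //; apply: val_inj.
Qed.

Lemma card_steps p :
  #|[set q | (rstep p q || ustep p q) || (rstep q p || ustep q p)]| <= 4.
Proof.
have c1 (Q : pred cell) : {in Q &, forall x y, x = y} -> #|[set q | Q q]| <= 1.
  by move=> h; rewrite cardsE; apply/card_le1_eqP => x y xQ yQ; apply: h.
pose A1 := [set q | rstep p q]; pose A2 := [set q | ustep p q].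
pose A3 := [set q | rstep q p]; pose A4 := [set q | ustep q p].
have l1 : #|A1| <= 1.
  apply: c1 => -[a b] [a' b']; rewrite !unfold_in /= => /andP[/eqP /= <- /eqP e].
  by move=> /andP[/eqP /= <- /eqP e']; congr (_, _); apply: val_inj; rewrite /= -e -e'.
have l2 : #|A2| <= 1.
  apply: c1 => -[a b] [a' b']; rewrite !unfold_in /= => /andP[/eqP /= <- /eqP e].
  by move=> /andP[/eqP /= <- /eqP e']; congr (_, _); apply: val_inj; rewrite /= -e -e'.
have l3 : #|A3| <= 1.
  apply: c1 => -[a b] [a' b']; rewrite !unfold_in /= => /andP[/eqP /= -> /eqP e].
  move=> /andP[/eqP /= -> /eqP e']; congr (_, _); apply: val_inj.
  by apply: succn_inj; rewrite [LHS]e [RHS]e'.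
have l4 : #|A4| <= 1.
  apply: c1 => -[a b] [a' b']; rewrite !unfold_in /= => /andP[/eqP /= -> /eqP e].
  move=> /andP[/eqP /= -> /eqP e']; congr (_, _); apply: val_inj.
  by apply: succn_inj; rewrite [LHS]e [RHS]e'.
have -> : [set q | (rstep p q || ustep p q) || (rstep q p || ustep q p)]
    = (A1 :|: A2) :|: (A3 :|: A4) by apply/setP => q; rewrite !inE.
have := (leq_card_setU (A1 :|: A2) (A3 :|: A4)).1.
by have := (leq_card_setU A1 A2).1; have := (leq_card_setU A3 A4).1; lia.
Qed.

(** These intervals are disjoint for different classes and start at 5 or more, so the degree tells
    cells from leaves and padding and reveals the class. *)
Lemma deg_core lab K p :
  5 * cls p (lab K.2 p) <= deg lab (core K p) <= 5 * cls p (lab K.2 p) + 4.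
Proof.
set c := cls _ _; have /andP[_ c18] := cls_bounds p (lab K.2 p).
pose lf (a : 'I_90) : vert := inl (K, p, Some a).
have lfI : injective lf by move=> a b [].
have coreI : injective (core K) by move=> a b [].
have -> : deg lab (core K p) = 5 * c +
    #|[set q | (rstep p q || ustep p q) || (rstep q p || ustep q p)]|.
  have <- : #|[set a : 'I_90 | a < 5 * c]| = 5 * c by rewrite card_ord_lt // /c; lia.
  rewrite -(card_imset _ lfI) -(card_imset _ coreI) -cardsUI.
  rewrite [X in _ = _ + X](_ : _ = 0) ?addn0.
    apply: eq_card => v; rewrite !inE; apply/idP/orP.
      case: v => [[[K' q] [a|]]|x] //=.
        rewrite /link /= orbF => /and3P[/eqP <- /eqP <- ac]; left.
        by apply/imsetP; exists a; rewrite ?inE.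
      rewrite /link /= => vE; right; have KE : K' = K.
        by case/orP: vE => /andP[/eqP ->].
      apply/imsetP; exists q; last by rewrite KE.
      by move: vE; rewrite KE eqxx inE.
    case=> /imsetP[x]; rewrite inE => xE ->; rewrite /link /= !eqxx //=.
    by rewrite xE.
  apply/eqP; rewrite cards_eq0; apply/eqP/setP => v; rewrite !inE.
  by apply/negP => /andP[/imsetP[a _ ->] /imsetP[]].
by have := card_steps p; lia.
Qed.

Lemma deg_leaf lab K p a : deg lab (inl (K, p, Some a)) <= 1.
Proof.
apply: (@leq_trans #|[set core K p]|); last by rewrite cards1.
apply: subset_leq_card; apply/subsetP => v.
rewrite !inE /link /=; case: v => [[[K' q] [b|]]|x] //=.
by case/and3P=> /eqP -> /eqP ->.
Qed.

Lemma deg_pad lab x : deg lab (inr x) = 0.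
Proof.
apply/eqP; rewrite cards_eq0; apply/eqP/setP => v; rewrite !inE /link /=.
by case: v => [[[K q] [b|]]|y].
Qed.

(** [94 = 5 * 18 + 4], where 18 is the largest class. *)
Lemma deg_le lab u : deg lab u <= 94.
Proof.
case: u => [[[K p] [a|]]|x]; last by rewrite deg_pad.
  exact: leq_trans (deg_leaf _ _ _ _) _.
have /andP[_ h] := deg_core lab K p; have := cls_bounds p (lab K.2 p).
by move: h; rewrite /core; lia.
Qed.

End Pieces.

(** * Rigidity and edit distance *)

Section Rigidity.
Local Open Scope nat_scope.
Variables (m N L r : nat).
Notation cell := (cell L).
Notation comp := (comp m N).
Notation vert := (vert m N L r).
Notation word := (word L).
Notation core := (@core m N L r).
Variables (lab1 lab2 : 'I_N -> word) (psi : vert -> vert) (good : pred vert).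
Implicit Types (K : comp) (p q : cell) (u v : vert).
Hypothesis good_deg : forall u, good u -> deg lab1 u = deg lab2 (psi u).
Hypothesis good_link : forall u v,
  good u -> link lab1 u v -> link lab2 (psi u) (psi v).

Lemma good_core K p : good (core K p) -> exists K' p',
  psi (core K p) = core K' p' /\ cls p' (lab2 K'.2 p') = cls p (lab1 K.2 p).
Proof.
move=> /good_deg; have := deg_core r lab1 K p.
have /andP[cp _] := cls_bounds p (lab1 K.2 p).
case: (psi _) => [[[K' p'] [a|]]|x].
- by have := deg_leaf r lab2 K' p' a; lia.
- have := deg_core r lab2 K' p'; rewrite /core => d2 d1 E.
  by exists K', p'; split=> //; lia.
- by rewrite deg_pad; lia.
Qed.

(** The images are adjacent cells of one grid with the residues of [p] and [q]. Among the four
    possible steps only the one to the right fixes the row residue and adds 1 to the column residue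
    mod 3. *)
Lemma good_rstep K p q : good (core K p) -> good (core K q) -> rstep p q ->
  exists K' p' q', [/\ psi (core K p) = core K' p', psi (core K q) = core K' q'
    & rstep p' q'].
Proof.
move=> gp gq pq; have [K1 [p1 [E1 c1]]] := good_core gp.
have [K2 [q1 [E2 c2]]] := good_core gq.
have : link lab2 (psi (core K p)) (psi (core K q)).
  by apply: good_link => //; rewrite /link /= eqxx pq.
rewrite E1 E2 /link /= => lk; have K12 : K2 = K1.
  by case/orP: lk => /andP[/eqP ->].
subst K2; exists K1, p1, q1; split; [by []|by []|].
have [_ r1 s1] := cls_inj c1; have [_ r2 s2] := cls_inj c2.
move: pq lk r1 s1 r2 s2; rewrite eqxx /= /rstep /ustep -!(inj_eq val_inj) /=.
by move=> pq lk r1 s1 r2 s2; lia.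
Qed.

Lemma good_ustep K p q : good (core K p) -> good (core K q) -> ustep p q ->
  exists K' p' q', [/\ psi (core K p) = core K' p', psi (core K q) = core K' q'
    & ustep p' q'].
Proof.
move=> gp gq pq; have [K1 [p1 [E1 c1]]] := good_core gp.
have [K2 [q1 [E2 c2]]] := good_core gq.
have : link lab2 (psi (core K p)) (psi (core K q)).
  by apply: good_link => //; rewrite /link /= eqxx pq orbT.
rewrite E1 E2 /link /= => lk; have K12 : K2 = K1.
  by case/orP: lk => /andP[/eqP ->].
subst K2; exists K1, p1, q1; split; [by []|by []|].
have [_ r1 s1] := cls_inj c1; have [_ r2 s2] := cls_inj c2.
move: pq lk r1 s1 r2 s2; rewrite eqxx /= /rstep /ustep -!(inj_eq val_inj) /=.
by move=> pq lk r1 s1 r2 s2; lia.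
Qed.

Lemma good_row K (i : 'I_L) : (forall j, good (core K (i, j))) ->
  exists K' (i' : 'I_L), forall j, psi (core K (i, j)) = core K' (i', j).
Proof.
move=> gi; pose o : 'I_L := Ordinal (leq_ltn_trans (leq0n _) (ltn_ord i)).
have [K' [[i' j0] [E0 _]]] := good_core (gi o); exists K', i'.
have run k (j : 'I_L) : j = k :> nat ->
    exists2 l : 'I_L, l = j0 + k :> nat & psi (core K (i, j)) = core K' (i', l).
  elim: k j => [|k IH] j jk.
    by exists j0; rewrite ?addn0 // -E0; congr (psi (core K (i, _))); apply: val_inj.
  have kL : k < L by have := ltn_ord j; lia.
  have [l lE El] := IH (Ordinal kL) erefl.
  have st : rstep (i, Ordinal kL) (i, j) by rewrite /rstep /= eqxx jk eqxx.
  have [K1 [[i1 l1] [[i2 l2] [F1 F2 /andP[/= /eqP i12 /eqP l12]]]]] :=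
    good_rstep (gi _) (gi _) st.
  move: F1; rewrite El => -[EK Ei El1]; exists l2.
    by rewrite -l12 -El1 lE addnS.
  by rewrite F2 -i12 -EK -Ei.
move=> j; have [l lE ->] := run j j erefl.
(* The last cell of the row lands in column [j0 + L.-1], which must be below [L]; hence [j0 = 0]. *)
have lt : L.-1 < L by have := ltn_ord i; lia.
have [l' lE' _] := run L.-1 (Ordinal lt) erefl.
by congr (core K' (i', _)); apply: val_inj; have := ltn_ord l'; rewrite /=; lia.
Qed.

Lemma good_col K (j : 'I_L) : (forall i, good (core K (i, j))) ->
  exists K' (j' : 'I_L), forall i, psi (core K (i, j)) = core K' (i, j').
Proof.
move=> gj; pose o : 'I_L := Ordinal (leq_ltn_trans (leq0n _) (ltn_ord j)).
have [K' [[i0 j'] [E0 _]]] := good_core (gj o); exists K', j'.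
have run k (i : 'I_L) : i = k :> nat ->
    exists2 l : 'I_L, l = i0 + k :> nat & psi (core K (i, j)) = core K' (l, j').
  elim: k i => [|k IH] i ik.
    by exists i0; rewrite ?addn0 // -E0; congr (psi (core K (_, j))); apply: val_inj.
  have kL : k < L by have := ltn_ord i; lia.
  have [l lE El] := IH (Ordinal kL) erefl.
  have st : ustep (Ordinal kL, j) (i, j) by rewrite /ustep /= eqxx ik eqxx.
  have [K1 [[l1 j1] [[l2 j2] [F1 F2 /andP[/= /eqP j12 /eqP l12]]]]] :=
    good_ustep (gj _) (gj _) st.
  move: F1; rewrite El => -[EK El1 Ej]; exists l2.
    by rewrite -l12 -El1 lE addnS.
  by rewrite F2 -j12 -EK -Ej.
move=> i; have [l lE ->] := run i i erefl.
have lt : L.-1 < L by have := ltn_ord j; lia.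
have [l' lE' _] := run L.-1 (Ordinal lt) erefl.
by congr (core K' (_, j')); apply: val_inj; have := ltn_ord l'; rewrite /=; lia.
Qed.

(** An undamaged row has [L] cells and keeps its direction, so it fills a whole
    row; likewise for columns. One undamaged column then pins down the images of
    all undamaged rows. *)
Lemma rigid_component K :
    10 * #|[set p | ~~ good (core K p)]| < L ->
  exists K' : comp, 10 * hdist (lab1 K.2) (lab2 K'.2) < #|{: cell}|.
Proof.
set bad := [set p | _] => small.
pose bR := [set p.1 | p in bad]; pose bC := [set p.2 | p in bad].
have bRle : #|bR| <= #|bad| by exact: leq_imset_card.
have bCle : #|bC| <= #|bad| by exact: leq_imset_card.
have row_good i : i \notin bR -> forall j, good (core K (i, j)).
  move=> iR j; apply/negPn/negP => b; case/negP: iR.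
  by apply/imsetP; exists (i, j); rewrite ?inE.
have col_good j : j \notin bC -> forall i, good (core K (i, j)).
  move=> jC i; apply/negPn/negP => b; case/negP: jC.
  by apply/imsetP; exists (i, j); rewrite ?inE.
(* Fewer than [L] cells are bad, so some column avoids them all. *)
have [j0 j0C] : exists j, j \notin bC.
  apply/existsP; rewrite -negb_forall; apply/negP => /forallP all.
  have : #|bC| = L by rewrite -[RHS]card_ord; apply: eq_card => j; rewrite all.
  by lia.
have [K' [j' Ecol]] := good_col (col_good _ j0C); exists K'.
(* The cell [(i, j0)] lies on the good column, so its image is in row [i] of [K']; the whole row [i]
   follows, and equal classes give equal bits. *)
have agr i j : i \notin bR -> lab1 K.2 (i, j) = lab2 K'.2 (i, j).
  move=> iR; have [K1 [i1 Erow]] := good_row (row_good _ iR).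
  have := Erow j0; rewrite Ecol => -[EK Ei _].
  have [K2 [p2 [E2 c2]]] := good_core (row_good _ iR j).
  move: E2 c2; rewrite Erow -EK -Ei => -[<- <-] /cls_inj[-> _ _] //.
have sub : [set p | lab1 K.2 p != lab2 K'.2 p] \subset setX bR [set: 'I_L].
  apply/subsetP => -[i j]; rewrite !inE andbT; apply: contraR => /agr ->.
  by rewrite eqxx.
have := subset_leq_card sub; rewrite cardsX cardsT card_ord => le.
rewrite card_prod !card_ord.
apply: (@leq_ltn_trans (10 * (#|bR| * L))); first by rewrite leq_mul2l.
by rewrite mulnA ltn_mul2r; apply/andP; split; lia.
Qed.

End Rigidity.

(** * Edit distance between coded graphs *)

Section CodedGraphs.
Local Open Scope nat_scope.
Variables (m N L r n : nat).
Notation cell := (cell L).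
Notation comp := (comp m N).
Notation vert := (vert m N L r).
Notation word := (word L).
Variables (dec : 'I_n -> vert) (enc : vert -> 'I_n).
Hypotheses (decK : cancel dec enc) (encK : cancel enc dec).
Implicit Types (lab : 'I_N -> word) (K : comp) (u v : vert).

Let dec_inj : injective dec := can_inj decK.
Let enc_inj : injective enc := can_inj encK.

Definition coded lab : sgraph n := graph_of (fun x y => arrow lab (dec x) (dec y)).

Lemma adj_coded lab x y : adj (coded lab) x y = link lab (dec x) (dec y).
Proof.
rewrite adj_graph_of; case: eqP => //= ->.
by rewrite /link arrow_irr.
Qed.

Lemma card_nbrs_coded lab x : #|nbrs (coded lab) x| = deg lab (dec x).
Proof.
rewrite /deg -(card_imset _ enc_inj); apply: eq_card => y.
rewrite inE adj_coded; apply/idP/imsetP => [xy|[v + ->]]; last by rewrite inE encK.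
by exists (dec y); rewrite ?inE ?decK.
Qed.

Lemma max_degree_coded lab : max_degree (coded lab) <= 94.
Proof. by apply/bigmax_leqP => x _; rewrite card_nbrs_coded deg_le. Qed.

Definition part v : option 'I_N := if v is inl (K, _, _) then Some K.2 else None.

(** The neighbourhood of a vertex depends only on the word of its own component, which is why one
    query reveals at most one word. *)
Lemma link_ext lab1 lab2 u v : (forall s, part u = Some s -> lab1 s = lab2 s) ->
  link lab1 u v = link lab2 u v.
Proof.
rewrite /link; case: u => [[[K p] [a|]]|x] /=; case: v => [[[K' q] [b|]]|y] //= E.
- by case: eqP => //= ->; rewrite ?orbF ?E.
- by rewrite E.
Qed.

Definition relabel_fun (s : {perm 'I_N}) v : vert :=
  match v with
  | inl (K, p, o) => inl (K.1, s K.2, p, o)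
  | inr x => inr x
  end.

Lemma relabel_inj s : injective (relabel_fun s).
Proof.
by move=> [[[[c t] p] o]|x] [[[[c' t'] p'] o']|x'] //= [-> // /perm_inj -> -> ->].
Qed.

(** Moving the components along with their words undoes a permutation of the words. *)
Lemma coded_isomorphic lab (s : {perm 'I_N}) :
  isomorphic (coded (lab \o s)) (coded lab).
Proof.
have fI : injective (enc \o relabel_fun s \o dec).
  by move=> x y /enc_inj /relabel_inj /dec_inj.
apply/existsP; exists (perm fI); apply/forallP => x; apply/forallP => y.
rewrite !adj_coded !permE /= !encK; apply/eqP; rewrite /link.
have arr u v : arrow (lab \o s) u v = arrow lab (relabel_fun s u) (relabel_fun s v).
  case: u v => [[[[c t] p] [a|]]|?] [[[[c' t'] p'] [b|]]|?] //=.
  - by rewrite !xpair_eqE (inj_eq perm_inj).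
  - by rewrite !xpair_eqE (inj_eq perm_inj).
by rewrite !arr.
Qed.

(** A vertex whose neighbourhood changes lies on an edited edge, and an edge has two ends. *)
Lemma card_damaged (G K : sgraph n) :
  #|[set x | nbrs G x != nbrs K x]| <= 2 * edits G K.
Proof.
rewrite /edits; set S := _ :|: _.
have sub : [set x | nbrs G x != nbrs K x] \subset cover S.
  apply/subsetP => x; rewrite inE; apply: contraR => xS.
  apply/eqP/setP => y; rewrite !inE; apply/idP/idP => xy.
    apply/negPn/negP => nxy; case/negP: xS; apply/bigcupP; exists [set x; y].
      by rewrite !inE; rewrite /adj in xy nxy; rewrite xy nxy.
    by rewrite !inE eqxx.
  apply/negPn/negP => nxy; case/negP: xS; apply/bigcupP; exists [set x; y].
    by rewrite !inE; rewrite /adj in xy nxy; rewrite xy nxy orbT.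
  by rewrite !inE eqxx.
apply: leq_trans (subset_leq_card sub) _; apply: leq_trans (leq_card_cover S).1 _.
rewrite mulnC -sum_nat_const; apply: leq_sum => e; rewrite !inE.
have [cG cK] := (edges_card2 G, edges_card2 K).
case/orP=> /andP[_ eE]; first by have /forall_inP/(_ e eE)/eqP-> := cG.
by have /forall_inP/(_ e eE)/eqP-> := cK.
Qed.

(** A component whose word is far from all words of the other graph must have
    [L / 10] damaged vertices, and every edit damages at most two vertices. *)
Lemma coded_edit_distance lab1 lab2 (S : {set 'I_N}) :
    (forall s t, s \in S -> #|{: cell}| <= 10 * hdist (lab1 s) (lab2 t)) ->
  m * #|S| * L <= 20 * edit_distance (coded lab2) (coded lab1).
Proof.
move=> sep; rewrite /edit_distance; case: arg_minnP => [|G /existsP[s /forallP sE] _].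
  apply/existsP; exists 1%g; apply/forallP => x; apply/forallP => y.
  by rewrite !perm1.
(* [G] is a copy of [coded lab1] nearest to [coded lab2], and [phi] maps [coded lab1] onto it. Then
   [psi] reads the image in the coordinates of [coded lab2]. *)
pose phi := (s^-1)%g.
have adjG x y : adj (coded lab1) x y = adj G (phi x) (phi y).
  by have /forallP/(_ (phi y))/eqP -> := sE (phi x); rewrite !permKV.
pose psi v := dec (phi (enc v)).
pose dam := [set x | nbrs (coded lab2) x != nbrs G x].
pose good v := phi (enc v) \notin dam.
have nbE v : good v -> nbrs (coded lab2) (phi (enc v)) = nbrs G (phi (enc v)).
  by rewrite /good inE negbK => /eqP.
have good_deg v : good v -> deg lab1 v = deg lab2 (psi v).
  move=> /nbE E; rewrite -card_nbrs_coded E -{1}[v]encK -card_nbrs_coded.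
  rewrite -(card_imset _ (@perm_inj _ phi)); apply: eq_card => y; rewrite inE.
  apply/imsetP/idP => [[z + ->]|yE]; first by rewrite inE adjG.
  by exists (s y); rewrite ?permK // inE adjG permK.
have good_link u v : good u -> link lab1 u v -> link lab2 (psi u) (psi v).
  move=> /nbE E uv; rewrite -adj_coded; have : phi (enc v) \in nbrs G (phi (enc u)).
    by rewrite inE -adjG adj_coded !encK.
  by rewrite -E inE.
pose D K := [set p | ~~ good (core r K p)].
have Dle K : K.2 \in S -> L <= 10 * #|D K|.
  move=> KS; rewrite leqNgt; apply/negP => lt.
  have [K' ] := rigid_component good_deg good_link lt.
  by rewrite ltnNge sep.
have -> : m * #|S| = #|setX [set: 'I_m] S| by rewrite cardsX cardsT card_ord.
rewrite -sum_nat_const; apply: (@leq_trans (10 * #|dam|)); last first.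
  have := card_damaged (coded lab2) G; rewrite -/dam.
  by move: #|dam| (edits _ _) => a b; lia.
apply: (@leq_trans (\sum_(K in setX [set: 'I_m] S) 10 * #|D K|)).
  by apply: leq_sum => K; rewrite !inE => /Dle.
rewrite -big_distrr leq_mul2l /=.
(* Distinct bad cells give distinct damaged vertices, so the counts over the components add up. *)
pose h (x : comp * cell) := phi (enc (core r x.1 x.2)).
have hI : injective h by move=> [K p] [K' p'] /perm_inj/enc_inj[-> ->].
rewrite (eq_bigr (fun K => \sum_(p in D K) 1)) => [|K _]; last by rewrite sum1_card.
rewrite pair_big_dep sum1dep_card -(card_imset _ hI); apply: subset_leq_card.
apply/subsetP => x /imsetP[[K p]]; rewrite inE => /andP[_ /=].
by rewrite inE negbK => pd ->.
Qed.

End CodedGraphs.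

(** * Planarity *)

Section StraightLineDrawing.
Variables (R : realType) (m N L r n : nat).
Notation cell := (cell L).
Notation comp := (comp m N).
Notation vert := (vert m N L r).
Notation word := (word L).
Variables (dec : 'I_n -> vert) (enc : vert -> 'I_n).
Hypotheses (decK : cancel dec enc) (encK : cancel enc dec).
Variable lab : 'I_N -> word.
Implicit Types (K : comp) (u v : vert) (x y : 'I_n) (s t : R).

(** The grids stand side by side, each [L] columns wide, and the padding follows to their right. *)
Definition xbase v : nat :=
  match v with
  | inl (K, p, _) => (enum_rank K * L + p.2)%N
  | inr x => (#|{: comp}| * L + x)%N
  end.

Definition ybase v : nat := if v is inl (_, p, _) then p.1 else 0%N.

(** The leaves of a cell sit at height 1/2 inside the unit square whose lower left corner is the
    cell, at distinct abscissas. *)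
Definition leaf_dir (a : 'I_90) : R * R := (a.+1%:R / 91%:R, 2%:R^-1).

Definition offset v : R * R :=
  if v is inl (_, _, Some a) then leaf_dir a else (0, 0).

Definition spot v : R * R :=
  ((xbase v)%:R + (offset v).1, (ybase v)%:R + (offset v).2).

Definition dir (k : bool + 'I_90) : R * R :=
  match k with
  | inl true => (1, 0)
  | inl false => (0, 1)
  | inr a => leaf_dir a
  end.

Definition ray v k t : R * R :=
  ((xbase v)%:R + t * (dir k).1, (ybase v)%:R + t * (dir k).2).

(** Applied to both coordinates, this recovers the unit square of a point and the position inside
    it. *)
Lemma nat_frac_inj (a b : nat) s t : 0 <= s < 1 -> 0 <= t < 1 ->
  a%:R + s = b%:R + t -> a = b /\ s = t.
Proof.
move=> /andP[s0 s1] /andP[t0 t1] E; suff ab : a = b.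
  by split=> //; move: E; rewrite ab => /addrI.
have l1 : (a%:R : R) < b.+1%:R by rewrite -natr1; lra.
have l2 : (b%:R : R) < a.+1%:R by rewrite -natr1; lra.
by move: l1 l2; rewrite !ltr_nat !ltnS => h1 h2; apply/eqP; rewrite eqn_leq h1 h2.
Qed.

Lemma leaf_dir_bounds a : 0 < (leaf_dir a).1 < 1.
Proof.
rewrite /= divr_gt0 ?ltr0n //= ltr_pdivrMr ?ltr0n // mul1r ltr_nat.
by rewrite ltnS ltn_ord.
Qed.

Lemma leaf_dir_inj a b : (leaf_dir a).1 = (leaf_dir b).1 -> a = b.
Proof.
move=> /= /(congr1 (fun z => z * 91%:R)); rewrite !divfK ?pnatr_eq0 // => /eqP.
by rewrite eqr_nat => /eqP[/val_inj].
Qed.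

Lemma offset_bounds v : (0 <= (offset v).1 < 1) /\ (0 <= (offset v).2 < 1).
Proof.
case: v => [[[K p] [a|]]|x] /=; rewrite ?lexx ?ltr01 //.
by have /andP[/ltW -> ->] := leaf_dir_bounds a; split=> //; apply/andP; split; lra.
Qed.

Lemma dir_bounds k : (0 <= (dir k).1 <= 1) /\ (0 <= (dir k).2 <= 1).
Proof.
case: k => [[]|a] /=; rewrite ?lexx ?ler01 //.
by have /andP[/ltW -> /ltW ->] := leaf_dir_bounds a; split=> //; apply/andP; split; lra.
Qed.

Lemma scaled_dir_bounds k t : 0 < t < 1 ->
  (0 <= t * (dir k).1 < 1) /\ (0 <= t * (dir k).2 < 1).
Proof.
move=> /andP[t0 t1]; have [/andP[a0 a1] /andP[b0 b1]] := dir_bounds k.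
by split; apply/andP; split; nra.
Qed.

Lemma dir_parallel k l s t : 0 < s -> 0 < t ->
  s * (dir k).1 = t * (dir l).1 -> s * (dir k).2 = t * (dir l).2 -> k = l.
Proof.
move=> s0 t0; case: k l => [[]|a] [[]|b] //= E1 E2; try by exfalso; lra.
- by have /andP[b0 _] := leaf_dir_bounds b; exfalso; have := mulr_gt0 t0 b0; move: E1 => /=; lra.
- by have /andP[b0 _] := leaf_dir_bounds a; exfalso; have := mulr_gt0 s0 b0; move: E1 => /=; lra.
have st : s = t by lra.
congr inr; apply: leaf_dir_inj; apply: (mulfI (lt0r_neq0 s0)) => /=.
by rewrite E1 st.
Qed.

Lemma xbase_inj v v' : xbase v = xbase v' -> ybase v = ybase v' ->
  offset v = offset v' -> v = v'.
Proof.
have enc_inj (i i' j j' : nat) : (j < L)%N -> (j' < L)%N ->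
    (i * L + j)%N = (i' * L + j')%N -> i = i' /\ j = j'.
  move=> jL jL' E; have L0 : (0 < L)%N by exact: leq_ltn_trans jL.
  have ii : i = i'.
    by have := congr1 (fun z => z %/ L)%N E; rewrite /= !divnMDl // !divn_small // !addn0.
  by split=> //; move: E; rewrite ii => /addnI.
have low K (j : 'I_L) (x : 'I_r) : (enum_rank K * L + j)%N <> (#|{: comp}| * L + x)%N.
  move=> E.
  have := leq_mul2r L (enum_rank K).+1 #|{: comp}|; rewrite ltn_ord orbT.
  by rewrite mulSn; have := ltn_ord j; lia.
case: v v' => [[[K [i j]] o]|x] [[[K' [i' j']] o']|x'] /=.
- move=> /enc_inj[] // /val_inj/enum_rank_inj <- /val_inj <- /val_inj <- oE.
  congr (inl (_, _)).
  case: o o' oE => [a|] [b|] //= []; last 2 first.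
  - by have /andP[h _] := leaf_dir_bounds a => E; move: h; rewrite /= E ltxx.
  - by have /andP[h _] := leaf_dir_bounds b => E; move: h; rewrite /= -E ltxx.
  by move/leaf_dir_inj => ->.
- by move=> /low.
- by move=> /esym/low.
- by move=> /addnI/val_inj ->.
Qed.

Lemma spot_inj : injective spot.
Proof.
move=> u v [E1 E2]; have [u1 u2] := offset_bounds u; have [v1 v2] := offset_bounds v.
have [X o1] := nat_frac_inj u1 v1 E1; have [Y o2] := nat_frac_inj u2 v2 E2.
by apply: xbase_inj => //; rewrite (surjective_pairing (offset u)) o1 o2 -surjective_pairing.
Qed.

Lemma arrow_ray u v : arrow lab u v ->
  exists k, spot u = ray u k 0 /\ spot v = ray u k 1.
Proof.
case: u v => [[[K p] [a|]]|x] [[[K' q] [b|]]|y] //=.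
  move=> /and3P[/eqP <- /eqP <- _]; exists (inr b).
  by rewrite /spot /ray /= !mul0r !mul1r.
case/andP=> /eqP <- /orP[] /andP[/eqP E1 /eqP E2].
  exists (inl true); rewrite /spot /ray /= -E2 E1 !mul0r !addr0 !mul1r; split=> //.
  by rewrite addnS -natr1 addr0.
exists (inl false); rewrite /spot /ray /= -E2 E1 !mul0r !addr0 !mul1r; split=> //.
by rewrite addr0 -natr1.
Qed.

(** The [pick] recovers an orientation of the edge; [(0, 0)] is a dummy value off the edges. *)
Definition draw_arc (e : {set 'I_n}) (t : R) : R * R :=
  if [pick p : 'I_n * 'I_n | (e == [set p.1; p.2]) && arrow lab (dec p.1) (dec p.2)]
    is Some p
  then let a := spot (dec p.1) in let b := spot (dec p.2) in
    (a.1 + t * (b.1 - a.1), a.2 + t * (b.2 - a.2))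
  else (0, 0).

Lemma draw_arcP e : e \in edges (coded dec lab) -> exists x y k,
  [/\ e = [set x; y], spot (dec x) = ray (dec x) k 0,
      spot (dec y) = ray (dec x) k 1 & forall t, draw_arc e t = ray (dec x) k t].
Proof.
case/imsetP => -[x y]; rewrite inE /= => /andP[xy _] eE.
rewrite /draw_arc; case: pickP => [[x' y'] /= /andP[/eqP e' /arrow_ray[k [E0 E1]]]|].
  exists x', y', k; split=> // t; move: E0 E1; rewrite /spot /ray /=.
  by move=> [-> ->] [-> ->]; congr (_, _); ring.
by move=> /(_ (x, y)); rewrite /= eE eqxx xy.
Qed.

Lemma ray_simple_arc v k : simple_arc (ray v k) (ray v k 0) (ray v k 1).
Proof.
split=> //.
  have line (a b : R) : continuous (fun t => a + t * b).
    move=> t; apply: cvgD; first exact: cvg_cst.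
    by apply: cvgM; [exact: cvg_id|exact: cvg_cst].
  apply: continuous_subspaceT => t.
  by have := cvg_pair (line _ _ t) (line _ _ t); apply.
move=> s t _ _ [/addrI E1 /addrI E2].
case: k E1 E2 => [[]|a] /=; rewrite ?mulr1 // => _.
by apply: mulIf; rewrite invr_eq0 pnatr_eq0.
Qed.

(** An interior point of an edge lies in the half-open unit square at the tail of that edge. Its
    integer parts give the tail and its fractional parts the direction, hence the edge. *)
Lemma coded_planar : planar R (coded dec lab).
Proof.
exists (spot \o dec), draw_arc; split.
- exact: inj_comp spot_inj (can_inj decK).
- move=> e /draw_arcP[x [y [k [eE x0 y1 tE]]]]; exists x, y; split=> //=.
  rewrite x0 y1 (_ : draw_arc e = ray (dec x) k); first exact: ray_simple_arc.
  exact: funext.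
- move=> e t v /draw_arcP[x [y [k [_ _ _ ->]]]]; rewrite in_itv /= => t01 [E1 E2].
  have [d1 d2] := scaled_dir_bounds k t01; have [b1 b2] := offset_bounds (dec v).
  have [_ F1] := nat_frac_inj d1 b1 E1; have [_ F2] := nat_frac_inj d2 b2 E2.
  case/andP: t01 => t0 t1; have off_core : (offset (dec v)).2 = 0 ->
      (offset (dec v)).1 = 0 -> False.
    move=> o20 o10; move: F1 F2; rewrite o20 o10.
    by case: (k) => [[]|a] /=; lra.
  move: F1 F2 off_core; rewrite /offset; case: (dec v) => [[[K p] [b|]]|z] F1 F2 H;
    try exact: H.
  (* A leaf inside an edge must be the end of that edge, at parameter 1, which is excluded. *)
  have k_b : k = inr b.
    by apply: (dir_parallel t0 ltr01); rewrite mul1r.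
  by move: F2; rewrite k_b /=; lra.
- move=> e f s t /draw_arcP[x [y [k [eE x0 y1 ->]]]].
  move=> /draw_arcP[x' [y' [k' [fE x0' y1' ->]]]] ef.
  rewrite !in_itv /= => s01 t01 [E1 E2]; case/eqP: ef.
  have [d1 d2] := scaled_dir_bounds k s01; have [d1' d2'] := scaled_dir_bounds k' t01.
  have [X F1] := nat_frac_inj d1 d1' E1; have [Y F2] := nat_frac_inj d2 d2' E2.
  have [s0 t0] : 0 < s /\ 0 < t by case/andP: s01 => -> _; case/andP: t01.
  have kk := dir_parallel s0 t0 F1 F2; subst k'.
  have rr z : ray (dec x) k z = ray (dec x') k z by rewrite /ray X Y.
  have xx : x = x' by apply: (can_inj decK); apply: spot_inj; rewrite x0 x0' rr.
  have yy : y = y' by apply: (can_inj decK); apply: spot_inj; rewrite y1 y1' rr.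
  by rewrite eE fE xx yy.
Qed.

End StraightLineDrawing.

(** * Query lower bound *)

Section Indistinguishability.
Variable R : realType.

(** Integrate the pointwise comparison of two sums of indicators. *)
Lemma sum_measure_le d (W : measurableType d) (mu : {measure set W -> \bar R})
    (I J : finType) (S : I -> W -> bool) (T : J -> W -> bool) :
    (forall i, measurable [set w | S i w]%classic) ->
    (forall j, measurable [set w | T j w]%classic) ->
    (forall w, #|[set i | S i w]| <= #|[set j | T j w]|)%N ->
  (\sum_i mu [set w | S i w]%classic <= \sum_j mu [set w | T j w]%classic)%E.
Proof.
move=> mS mT ST.
pose ind (K : finType) (U : K -> W -> bool) k w : \bar R :=
  (\1_[set w | U k w]%classic w)%:E.
pose cnt (K : finType) (U : K -> W -> bool) w : \bar R := (\sum_k ind K U k w)%E.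
have int (K : finType) (U : K -> W -> bool) :
    (forall k, measurable [set w | U k w]%classic) ->
    [/\ measurable_fun [set: W]%classic (cnt K U),
        (\sum_k mu [set w | U k w]%classic)%E = (\int[mu]_w cnt K U w)%E
      & forall w, cnt K U w = (#|[set k | U k w]|%:R : R)%:E].
  move=> mU; have mI k : measurable_fun [set: W]%classic (ind K U k).
    apply/measurable_EFinP; exact: measurable_indic.
  split.
  - exact: emeasurable_sum.
  - rewrite ge0_integral_sum //=; last by move=> k w _; rewrite lee_fin.
    by apply: eq_bigr => k _; rewrite integral_indic // classical_sets.setIT.
  - move=> w; rewrite /cnt /ind sumEFin; congr EFin; rewrite -sum1dep_card natr_sum.
    rewrite [RHS]big_mkcond /=; apply: eq_bigr => k _; rewrite indicE.
    have -> : (w \in [set w | U k w]%classic) = U k w.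
      by apply/idP/idP; rewrite boolp.asboolE.
    by case: (U k w).
have [mfS -> eS] := int _ _ mS; have [mfT -> eT] := int _ _ mT.
apply: ge0_le_integral => // w _; first by rewrite eS lee_fin ler0n.
by rewrite eS eT lee_fin ler_nat.
Qed.

Lemma card_preim_sum (I K : finType) (f : I -> K) (Q : pred K) :
  (\sum_(w | Q w) #|[set i | f i == w]| = #|[set i | Q (f i)]|)%N.
Proof.
rewrite -[RHS]sum1dep_card (partition_big f Q) //=; apply: eq_bigr => w Qw.
rewrite -sum1dep_card; apply: eq_bigl => i.
by case: eqP => [->|]; rewrite ?Qw ?andbF.
Qed.

(** For fixed coins, domination on cylinders passes to acceptance. Averaging over the coins gives
    [(1 - q ^ 2 / P) * 2 / 3 <= 1 / 3]. *)
Lemma indistinguishability (d n : nat) (T : finType) (pos : 'I_n -> T)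
    (ans : 'I_n -> 'I_d -> T -> option 'I_n) (A : ralgo R d n) (P q : nat)
    (h : 'I_P -> T) :
    injective h ->
    (forall c w, num_queries (strategy (r := A) c) (word_oracle pos ans w) <= q)%N ->
    (forall r : {perm T}, ((2 / 3)%:E <=
       prob_accept A (word_oracle pos ans [ffun t => r t]))%E) ->
    (forall (r : {perm T}) (g : {ffun T -> 'I_P}),
       (prob_accept A (word_oracle pos ans [ffun t => r (h (g t))])
         <= (3^-1)%:E)%E) ->
  (P <= 2 * q ^ 2)%N.
Proof.
move=> hI Aq acc rej.
(* The weights [a] and [P] become sizes of index sets, so the comparison is one of cardinalities. *)
pose a := ((P - q ^ 2) * #|{ffun T -> 'I_P}|)%N.
pose S (i : 'I_a * {perm T}) c :=
  accepts (strategy (r := A) c) (word_oracle pos ans [ffun t => i.2 t]).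
pose U (j : 'I_P * ({perm T} * {ffun T -> 'I_P})) c :=
  accepts (strategy (r := A) c) (word_oracle pos ans [ffun t => j.2.1 (h (j.2.2 t))]).
have count c : (#|[set i | S i c]| <= #|[set j | U j c]|)%N.
  pose mu (w : {ffun T -> T}) := (a * #|[set r : {perm T} | [ffun t => r t] == w]|)%N.
  pose nu (w : {ffun T -> T}) := (P * #|[set x : {perm T} * {ffun T -> 'I_P} |
    [ffun t => x.1 (h (x.2 t))] == w]|)%N.
  have dom (D : {set T}) (w : {ffun T -> T}) : (#|D| <= q)%N -> (\sum_(w' | agree D w w') mu w'
      <= \sum_(w' | agree D w w') nu w')%N.
    by move=> Dq; rewrite -!big_distrr /= !card_preim_sum; exact: perm_comp_domination.
  have := dtree_domination dom (Aq c).
  rewrite -!big_distrr /= !card_preim_sum.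
  have cs (k : nat) (I : finType) (Q : pred I) :
      #|[set i : 'I_k * I | Q i.2]| = (k * #|[set i | Q i]|)%N.
    have -> : [set i : 'I_k * I | Q i.2] = setX [set: 'I_k] [set i | Q i].
      by apply/setP => i; rewrite !inE.
    by rewrite cardsX cardsT card_ord.
  by rewrite (cs a _ (fun r : {perm T} => accepts _ (word_oracle _ _ [ffun t => r t])))
    (cs P _ (fun x : {perm T} * {ffun T -> 'I_P} =>
       accepts _ (word_oracle _ _ [ffun t => x.1 (h (x.2 t))]))).
have := @sum_measure_le _ _ (coins_prob A) _ _ S U
  (fun i => measurable_accepts A _) (fun j => measurable_accepts A _) count.
have lo : ((\sum_(i : 'I_a * {perm T}) (2 / 3 : R)%:E)%E <=
    \sum_i coins_prob A [set c | S i c]%classic)%E.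
  by apply: lee_sum => i _; exact: acc.
have hi : (\sum_j coins_prob A [set c | U j c]%classic <=
    (\sum_(j : 'I_P * ({perm T} * {ffun T -> 'I_P})) (3^-1 : R)%:E)%E)%E.
  by apply: lee_sum => j _; exact: rej.
move=> /(le_trans lo)/le_trans/(_ hi); rewrite !sumEFin lee_fin !sumr_const.
rewrite -[leLHS]mulr_natr -[leRHS]mulr_natr !card_prod !card_ord /a !natrM.
set G : R := #|{ffun T -> 'I_P}|%:R; set B : R := #|{perm T}|%:R.
have [->//|P0] := posnP P.
have B0 : 0 < B by rewrite ltr0n; apply/card_gt0P; exists 1%g.
have G0 : 0 < G by rewrite ltr0n card_ffun card_ord expn_gt0 P0.
have [|lt] := leqP P (q ^ 2); first by lia.
rewrite (natrB _ (ltnW lt)) => le.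
have {}le : (2 * (P%:R - (q ^ 2)%:R) - P%:R) * (G * B) <= 0 :> R by lra.
have GB : 0 < G * B by rewrite mulr_gt0.
move: le; rewrite pmulr_lle0 // => le.
have : P%:R <= (2 * q ^ 2)%:R :> R by rewrite natrM; lra.
by rewrite ler_nat.
Qed.

End Indistinguishability.

Section TesterLowerBound.
Local Open Scope nat_scope.
Variables (R : realType) (m L r n P : nat).
Notation N := P.*2.
Notation cell := (cell L).
Notation vert := (vert m N L r).
Notation word := (word L).
Variables (dec : 'I_n -> vert) (enc : vert -> 'I_n).
Hypotheses (decK : cancel dec enc) (encK : cancel enc dec).
Variable x : 'I_N -> word.
Hypothesis x_sep : forall s t, s != t -> #|{: cell}| <= 10 * hdist (x s) (x t).
Variable eps : R.
Hypothesis far_edits : forall e : nat, m * P * L <= 20 * e ->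
  (eps < e%:R / (94 * n)%N%:R)%R.
Hypothesis P_gt0 : 0 < P.

Let N_gt0 : 0 < N.
Proof. by rewrite double_gt0. Qed.

(** The default only concerns padding vertices, whose neighbourhood is empty for all words. *)
Let pos (v : 'I_n) : 'I_N :=
  odflt (Ordinal N_gt0) (part (dec v)).

(** Giving every component the word [x y] yields the right neighbours of [v] once [y] is the index
    assigned to its own component. *)
Let ans (v : 'I_n) (i : 'I_94) (y : 'I_N) : option 'I_n :=
  onth (enum (nbrs (coded dec (fun=> x y)) v)) i.

Lemma word_oracle_input (w : {ffun 'I_N -> 'I_N}) :
  is_input (coded dec (x \o w)) (word_oracle pos ans w).
Proof.
split; first exact: max_degree_coded decK encK _.
move=> v; exists (enum (nbrs (coded dec (x \o w)) v)) => // i.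
rewrite /word_oracle /ans; congr (onth (enum (_ : {set 'I_n})) _).
apply/setP => y; rewrite !inE !adj_coded; apply: link_ext => s sE.
by rewrite /pos sE.
Qed.

Lemma tester_lower_bound (A : ralgo R 94 n) (q : nat) :
    is_tester eps (coded dec x) A -> makes_at_most A q ->
  P <= 2 * q ^ 2.
Proof.
move=> tA qA; have leP2 : P <= N by rewrite -addnn leq_addl.
(* Composed with a random permutation, [h] selects a random set of [P] indices. *)
pose h (i : 'I_P) : 'I_N := widen_ord leP2 i.
have hI : injective h by move=> i j /(congr1 val) /= /val_inj.
have coreq w := word_oracle_input w.
apply: (indistinguishability (pos := pos) (ans := ans) (A := A) hI).
- by move=> c w; apply: qA (coreq w) c.
- move=> s; have [+ _] := tA _ _ (coreq [ffun t => s t]); apply.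
  have -> : x \o [ffun t => s t] = x \o s by apply: funext => t /=; rewrite ffunE.
  exact: coded_isomorphic decK encK _ _.
- move=> s g; set w := [ffun t => _].
  have [_] := tA _ _ (coreq w); have fr : far 94 eps (coded dec (x \o w)) (coded dec x).
    apply: far_edits.
    (* [S] indexes the words missing from the no-instance: at most [P] of the [2 P] indices are
       hit. *)
    pose S := ~: [set w t | t : 'I_N].
    have SP : P <= #|S|.
      have : #|[set w t | t : 'I_N]| <= P.
        have -> : [set w t | t : 'I_N] = [set s (h i) | i in [set g t | t : 'I_N]].
          by rewrite -imset_comp; apply: eq_imset => t; rewrite ffunE.
        by apply: leq_trans (leq_imset_card _ _) _; rewrite -[X in _ <= X]card_ord max_card.
      by have := cardsC [set w t | t : 'I_N]; rewrite card_ord -/S; lia.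
    apply: (@leq_trans (m * #|S| * L)); first by rewrite leq_mul2r leq_mul2l SP !orbT.
    apply: (coded_edit_distance decK encK) => a b; rewrite inE => aS; apply: x_sep.
    by apply: contraNneq aS => ->; apply/imsetP; exists b.
  move=> /(_ fr); rewrite /prob_reject /prob_accept.
  have mA := measurable_accepts A (word_oracle pos ans w).
  have -> : [set c : coins A | ~~ accepts (strategy c) (word_oracle pos ans w)]%classic
      = (~` [set c | accepts (strategy c) (word_oracle pos ans w)])%classic.
    by apply/seteqP; split=> c /= /negP.
  rewrite probability_setC //.
  have /fineK <- := fin_num_measure (coins_prob A) _ mA.
  by move: (fine _) => a; rewrite (_ : (1 - a%:E)%E = (1 - a)%:E) // !lee_fin; lra.
Qed.

End TesterLowerBound.

(** * Choice of parameters *)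

Lemma bijection_with_ordinal (T : finType) (n : nat) : #|T| = n ->
  exists (dec : 'I_n -> T) (enc : T -> 'I_n), cancel dec enc /\ cancel enc dec.
Proof.
move=> E; exists (fun i => enum_val (cast_ord (esym E) i)).
exists (fun v => cast_ord E (enum_rank v)); split=> v.
  by rewrite enum_valK cast_ordKV.
by rewrite cast_ordK enum_rankK.
Qed.

Lemma expR1_lt4 (R : realType) : expR 1 <= 4 :> R.
Proof.
have h := expR_ge1Dx (- (1 / 2) : R); have p := expR_gt0 (1 / 2 : R).
have i := expRxMexpNx_1 (1 / 2 : R).
have -> : (1 : R) = 1 / 2 + 1 / 2 by lra.
rewrite expRD; suff : expR (1 / 2) <= 2 :> R by nra.
nra.
Qed.

(** From [c <= 4 * q ^ 2 + 1 <= 8 * q ^ 2] follows [8 ^ k <= 8 ^ 10 * q ^ 20], and [8 ^ 10]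
    cancels. *)
Lemma code_size_le_queries (k c P q : nat) :
    (10 <= k -> 8 ^ k <= c ^ 10 -> c <= P.*2.+1 -> P <= 2 * q ^ 2 -> 0 < q ->
  8 ^ (k - 10) <= q ^ 20)%N.
Proof.
move=> k10 kc cP Pq q0; have c_le : (c <= 8 * q ^ 2)%N by apply: (leq_trans cP); nia.
have := leq_trans kc (leq_wexp2r 10 c_le).
by rewrite -{1}(subnKC k10) expnD expnMn -expnM leq_pmul2l ?expn_gt0.
Qed.

Theorem theorem1p2 (R : realType) :
  exists (c : R) (d : nat), 0 < c /\
  exists eps0 : R, 0 < eps0 /\
  forall eps : R, 0 < eps -> eps < eps0 ->
  exists n0 : nat, forall n : nat, (n0 <= n)%N ->
  exists H : sgraph n,
    [/\ planar R H,
        (max_degree H <= d)%N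
      & forall A : ralgo R d n, is_tester eps H A ->
        forall q : nat, makes_at_most A q -> expR (c / eps ^+ 2) <= q%:R].
Proof.
(* [C] exceeds [94 * 364 * 20]: the degree bound, the ratio of [n] to [m * P * L * L], and the
   factor lost in the edit distance. *)
have [C CE] : exists C : R, C = 1000 * 1000 by eexists.
have C0 : 0 < C by rewrite CE; lra.
(* [160 = 20 * 8]: 20 is the exponent of [q], and 8 leaves room for rounding [L] and for
   [k - 10]. *)
exists (160 * C ^+ 2)^-1, 94%N; split.
  by rewrite invr_gt0; apply: mulr_gt0; [rewrite ltr0n|exact: exprn_gt0].
(* This threshold ensures [L >= 10]. *)
exists (10 * C)^-1; split; first by rewrite invr_gt0 mulr_gt0.
move=> eps eps_gt0 eps_lt; pose L := Num.truncn (C * eps)^-1.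
have Ce : 0 < C * eps by rewrite mulr_gt0.
have /andP[L_le L_gt] : L%:R <= (C * eps)^-1 < L.+1%:R.
  by apply: truncn_itv; rewrite invr_ge0 ltW.
have L10 : (10 <= L)%N.
  have inv0 : 0 <= (C * eps)^-1 by rewrite invr_ge0 ltW.
  rewrite /L truncn_ge_nat // -[leRHS]mul1r ler_pdivlMr //.
  by move: eps_lt; rewrite -[ltRHS]mul1r ltr_pdivlMr ?mulr_gt0 //; lra.
clearbody L; have L_gt0 : (0 < L)%N := leq_trans (isT : 0 < 10)%N L10.
have [F [F_sep F_card]] := gilbert_varshamov (cell L).
have [k kE] : exists k, k = (L * L)%N by eexists.
have cellE : #|{: cell L}| = k by rewrite card_prod card_ord kE.
rewrite cellE in F_card F_sep.
have F2 : (1 < #|F|)%N.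
  rewrite ltnNge; apply/negP => F1.
  have := leq_trans F_card (leq_wexp2r 10 F1); rewrite exp1n leqNgt.
  by case/negP; rewrite -{1}(exp1n k) ltn_exp2r // kE muln_gt0 L_gt0.
have [P [P_gt0 FP PF]] : exists P, [/\ (0 < P)%N, (P.*2 <= #|F|)%N & (#|F| <= P.*2.+1)%N].
  exists #|F|./2; rewrite half_gt0 F2 -{2 3}[#|F|]odd_double_half.
  by rewrite leq_addl -add1n leq_add2r leq_b1.
(* The size of one copy of each of the [2 P] grids, a cell taking 91 vertices with its slots; larger
   [n] thus allow [m >= 1]. *)
exists (P.*2 * (L * L) * 91)%N => n n_ge.
have u_gt0 : (0 < P.*2 * (L * L) * 91)%N by rewrite !muln_gt0 double_gt0 P_gt0 L_gt0.
have [m [r [m_gt0 nE r_lt]]] : exists m r, [/\ (0 < m)%N,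
    n = (m * (P.*2 * (L * L) * 91) + r)%N & (r < P.*2 * (L * L) * 91)%N].
  exists (n %/ (P.*2 * (L * L) * 91))%N, (n %% (P.*2 * (L * L) * 91))%N.
  by rewrite divn_gt0 // n_ge -divn_eq ltn_pmod.
pose N := P.*2.
have [dec [enc [decK encK]]] : exists (dec : 'I_n -> vert m N L r) enc,
    cancel dec enc /\ cancel enc dec.
  apply: bijection_with_ordinal.
  rewrite card_sum !card_prod card_option !card_ord nE.
  by rewrite !mulnA.
pose x (s : 'I_N) : word L := nth [ffun=> false] (enum F) s.
have sF (s : 'I_N) : (s < size (enum F))%N.
  rewrite -cardE; exact: leq_trans (ltn_ord s) _.
have x_sep s t : s != t -> (#|{: cell L}| <= 10 * hdist (x s) (x t))%N.
  have xF i : x i \in F by rewrite -mem_enum mem_nth.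
  by move=> st; rewrite cellE F_sep // nth_uniq ?enum_uniq.
exists (coded dec x); split; first exact: coded_planar decK _.
  exact: max_degree_coded decK encK _.
move=> A tA q qA.
have far_edits e : (m * P * L <= 20 * e)%N -> eps < e%:R / (94 * n)%N%:R.
  (* The padding is smaller than one block, so [n] is at most twice [m * (2 P) * L ^ 2 * 91]. *)
  move=> le_e; have n_le : (n <= 364 * (m * P * L * L))%N.
    by rewrite {1}nE; move: (r_lt) m_gt0; rewrite -/N; nia.
  have n_gt0 : (0 < n)%N by exact: leq_trans n_ge.
  rewrite ltr_pdivlMr ?ltr0n ?muln_gt0 // natrM.
  set M := (m * P * L)%N in le_e n_le *.
  have M0 : 0 < M%:R :> R by rewrite ltr0n !muln_gt0 m_gt0 P_gt0.
  have Ls : C * eps * L%:R <= 1.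
    by move: L_le; rewrite -[leRHS]mul1r ler_pdivlMr // mulrC.
  have h1 : C * eps * L%:R * M%:R <= M%:R by rewrite ler_piMl // ltW.
  have h2 : eps * n%:R <= eps * (364 * (M%:R * L%:R)).
    by rewrite ler_pM2l // -!natrM ler_nat.
  have h3 : M%:R <= 20 * e%:R :> R by rewrite -natrM ler_nat.
  by rewrite CE in h1; lra.
have P_le := tester_lower_bound decK encK x_sep far_edits P_gt0 tA qA.
have q_gt0 : (0 < q)%N by case: (q) P_le => // P0; have := leq_trans P_gt0 P0.
have k10 : (10 <= k)%N by rewrite kE; apply: leq_trans (leq_mul L10 L10).
have k_le := code_size_le_queries k10 F_card PF P_le q_gt0.
have exp_le : 20 * ((160 * C ^+ 2)^-1 / eps ^+ 2) <= (k - 10)%N%:R :> R.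
  rewrite natrB // kE natrM.
  have -> : (160 * C ^+ 2)^-1 / eps ^+ 2 = (C * eps)^-1 ^+ 2 / 160.
    by field; rewrite !lt0r_neq0.
  have L10' : 10 <= L%:R :> R by rewrite ler_nat.
  move: L_gt; rewrite -natr1; move: (L%:R) L10' => l; have : 0 < (C * eps)^-1 by rewrite invr_gt0.
  move: (_^-1) => y; nra.
(* Compare 20th powers, using [expR 1 <= 8] and [8 ^ (k - 10) <= q ^ 20]. *)
rewrite -(@ler_pXn2r _ 20) ?nnegrE ?ler0n ?expR_ge0 // -expRM_natl -natrX.
apply: le_trans (_ : expR (k - 10)%N%:R <= _); first by rewrite ler_expR.
apply: le_trans (_ : (8 ^ (k - 10))%N%:R <= _); last by rewrite ler_nat.
rewrite -[X in expR X]mulr1 expRM_natl natrX lerXn2r ?nnegrE ?expR_ge0 ?ler0n //.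
by apply: le_trans (expR1_lt4 R) _; rewrite ler_nat.
Qed.
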